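(* Let $X$ be a Euclidean polyhedral space, $U\subset X$ open, and $\Pi$ a polyhedral complex on $X$ such that $\Pi|_U$ is finite. Then there is a strongly concave piecewise affine function $f$ on $X$ such that $S(\Pi,f)|_U$ is finite and $f$ is strictly concave on $S(\Pi,f)|_U$. In particular, $S(\Pi,f)$ is a subdivision of $\Pi$ that is regular on $U$.
   Context: Polyhedral spaces. Let $X$ be a second countable topological space. A polyhedral structure $\Pi$ on $X$ is a locally finite covering of $X$ by distinct closed subsets $\sigma$ (polyhedra), each with a finite-dimensional vector space $M_\sigma$ of continuous real functions on $\sigma$ such that, with $N_\sigma=\operatorname{Hom}(M_\sigma,\mathbb{R})$, the evaluation map $\phi_\sigma\colon\sigma\to N_\sigma$ is a homeomorphism onto a full-dimensional convex polyhedron of an affine hyperplane of $N_\sigma$ not containing $0$. Faces of $\sigma$ are preimages of faces of $\phi_\sigma(\sigma)$ (including the empty face); every face of a polyhedron is a polyhedron of $\Pi$ with function space the restrictions of $M_\sigma$; any two polyhedra meet in a common face. Each polyhedron thus has an affine structure, dimension, facets, relative interior. $\Pi'$ subdivides $\Pi$ if each polyhedron of $\Pi'$ lies in one of $\Pi$ with affine inclusion; structures are equivalent if they have a common subdivision. A polyhedral space is $X$ with an equivalence class of structures; a polyhedral complex on $X$ is a member of the class. $\tau\prec\sigma$ means $\tau$ is a face of $\sigma$. A Euclidean polyhedral space is a polyhedral space $X$ with a finite-dimensional Euclidean vector space $N_X$ and a map $\iota\colon X\to N_X$ with image in an affine hyperplane $H_X\not\ni0$ such that some polyhedral complex has $\iota$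 injective and affine on each polyhedron; only such complexes are considered. For a nonempty facet $\tau$ of $\sigma$, $v_{\sigma\setminus\tau}$ is the unit vector orthogonal to the affine span of $\iota(\tau)$, parallel to that of $\iota(\sigma)$, pointing towards $\iota(\sigma)$. For $V$ open, $\Pi|_V$ is the set of polyhedra of $\Pi$ meeting $V$, $\Pi|_V(k)$ those of dimension $k$. A $k$-dimensional weight $c\colon\Pi|_V(k)\to\mathbb{R}$ is positive if $c\ge0$, a Minkowski weight if $\sum_{\sigma\in\Pi|_V(k),\sigma\succ\tau}c(\sigma)v_{\sigma\setminus\tau}=0$ for all $\tau\in\Pi|_V(k-1)$; $M^+_k(\Pi|_V)$ denotes positive Minkowski weights. A piecewise affine function on $V$ defined on $\Pi$ is $f\colon V\to\mathbb{R}$ affine on each $\sigma\cap V$, $\sigma\in\Pi|_V$; write $f=f_\sigma\circ\iota$ there with $f_\sigma$ linear; $(f\cdot c)(\tau)=-\sum_{\sigma\in\Pi|_V(k),\sigma\succ\tau}c(\sigma)f_\sigma(v_{\sigma\setminus\tau})$. A piecewise affine $f$ on $X$ is strongly concave if $f=f'\circ\iota$ for some $f'\colon H_X\to\mathbb{R}\cup\{\pm\infty\}$ whose hypograph is convex. Strict concavity and regularity: a piecewise affine $f$ on $U$ is strictly concave on $\Pi|_U$ if it is defined on $\Pi$ and for every integer $k$, every $\tau\in\Pi|_U(k)$, every open $V\subset U$ with $V\cap\tau\ne\emptyset$ and every $c\in M^+_{k+1}(\Pi|_V)$ with $c(\sigma)>0$ for some $\sigma\in\Pi|_V(k+1)$,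 $\sigma\succ\tau$, one has $(f\cdot c)(\tau)>0$. $\Pi$ is regular on $U$ if there is such an $f$. $S(\Pi,f)$: for a piecewise affine $f$ whose restriction to each polyhedron of $\Pi$ is concave, $S(\Pi,f)=\bigcup_{\sigma\in\Pi}\Pi(f|_\sigma)$, where $\Pi(f|_\sigma)$ is the set of subsets $\rho\subset\sigma$ for which some affine function $\ell$ on $\sigma$ satisfies $f=\ell$ on $\rho$ and $f<\ell$ on $\sigma\setminus\rho$. *)

(* Defs.v *)
From HB Require Import structures.
From mathcomp Require Import all_boot all_order all_algebra.
From mathcomp Require Import all_classical all_reals all_analysis.
Set Implicit Arguments. Unset Strict Implicit. Unset Printing Implicit Defensive.
Import Order.TTheory GRing.Theory Num.Theory.
Import numFieldNormedType.Exports.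
Local Open Scope classical_set_scope.
Local Open Scope ring_scope.

(* The Euclidean vector space N_X is modelled as 'rV[R]_n with the standard
   inner product; iota : X -> 'rV[R]_n is the map of the Euclidean polyhedral
   space, and H_X = [set y | dot y a = 1] (an affine hyperplane not through 0). *)

Section Defs.
Variables (R : realType) (n : nat) (X : topologicalType).
Variable iota : X -> 'rV[R]_n.

Definition dot (y z : 'rV[R]_n) : R := \sum_(j < n) y ord0 j * z ord0 j.

Definition is_polyhedron (P : set 'rV[R]_n) : Prop :=
  exists m (u : 'I_m -> 'rV[R]_n) (b : 'I_m -> R),
    P = [set y | forall i, dot y (u i) <= b i].

(* tau is a face of sigma: the preimage under iota|sigma of a face
   (possibly empty, possibly all) of the polyhedron iota(sigma) *)
Definition is_face (sigma tau : set X) : Prop :=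
  exists (u : 'rV[R]_n) (b : R), (forall x, sigma x -> dot (iota x) u <= b) /\
    tau = [set x | sigma x /\ dot (iota x) u = b].

Definition aff_indep k (p : 'I_k.+1 -> 'rV[R]_n) : bool :=
  row_free (\matrix_(i < k, j < n) (p (lift ord0 i) ord0 j - p ord0 ord0 j)).

Definition has_dim (S : set X) (k : nat) : Prop :=
  (exists p : 'I_k.+1 -> X, (forall i, S (p i)) /\ aff_indep (iota \o p)) /\
  (forall p : 'I_k.+2 -> X, (forall i, S (p i)) -> ~ aff_indep (iota \o p)).

Definition is_complex (Pi : set (set X)) : Prop :=
  (forall x, exists sigma, Pi sigma /\ sigma x) /\
  (forall x : X, exists W : set X, nbhs x W /\ finite_set [set sigma | Pi sigma /\ sigma `&` W !=set0]) /\
  (forall sigma, Pi sigma ->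
     [/\ closed sigma,
         (forall x y, sigma x -> sigma y -> iota x = iota y -> x = y),
         is_polyhedron (iota @` sigma),
         (* iota|sigma is a homeomorphism onto its image *)
         (forall A, A `<=` sigma ->
            (exists O, open O /\ A = sigma `&` O) <->
            (exists O : set 'rV[R]_n, open O /\ iota @` A = iota @` sigma `&` O)) &
         (forall tau, is_face sigma tau -> Pi tau)]) /\
  (forall sigma tau, Pi sigma -> Pi tau ->
     is_face sigma (sigma `&` tau) /\ is_face tau (sigma `&` tau)).

Definition subdivides (Pi' Pi : set (set X)) : Prop :=
  forall sigma', Pi' sigma' -> exists sigma, Pi sigma /\ sigma' `<=` sigma.

Definition equivalent (Pi1 Pi2 : set (set X)) : Prop :=
  exists Pi3, is_complex Pi3 /\ subdivides Pi3 Pi1 /\ subdivides Pi3 Pi2.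

Definition affine_on (f : X -> R) (A : set X) : Prop :=
  exists w : 'rV[R]_n, forall x, A x -> f x = dot (iota x) w.

(* piecewise affine function on X: affine on the polyhedra of some complex
   of the polyhedral space structure (i.e. equivalent to Pi) *)
Definition piecewise_affine (Pi : set (set X)) (f : X -> R) : Prop :=
  exists Pi', is_complex Pi' /\ equivalent Pi' Pi /\
    forall sigma, Pi' sigma -> affine_on f sigma.

(* strongly concave: f = f' \o iota with f' : H_X -> \bar R of convex hypograph *)
Definition strongly_concave (a : 'rV[R]_n) (f : X -> R) : Prop :=
  exists f' : 'rV[R]_n -> \bar R, (forall x, (f x)%:E = f' (iota x)) /\
    forall (y1 y2 : 'rV[R]_n) (t1 t2 lam : R),
      dot y1 a = 1 -> dot y2 a = 1 ->
      (t1%:E <= f' y1)%E -> (t2%:E <= f' y2)%E -> 0 <= lam -> lam <= 1 ->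
      ((lam * t1 + (1 - lam) * t2)%:E <= f' (lam *: y1 + (1 - lam) *: y2)%R)%E.

Definition S_of (Pi : set (set X)) (f : X -> R) : set (set X) :=
  [set rho | exists sigma, Pi sigma /\ rho `<=` sigma /\
     exists w : 'rV[R]_n, (forall x, rho x -> f x = dot (iota x) w) /\
                          (forall x, sigma x -> ~ rho x -> f x < dot (iota x) w)].

Definition restr (Pi : set (set X)) (V : set X) : set (set X) :=
  [set sigma | Pi sigma /\ sigma `&` V !=set0].
Definition restr_dim (Pi : set (set X)) (V : set X) (k : nat) : set (set X) :=
  [set sigma | restr Pi V sigma /\ has_dim sigma k].

(* v is the unit vector orthogonal to aff span iota(tau), parallel to the
   affine span of iota(sigma), pointing towards iota(sigma) *)
Definition normal_vec (sigma tau : set X) (v : 'rV[R]_n) : Prop :=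
  [/\ exists m (c : 'I_m -> R) (x y : 'I_m -> X),
        (forall i, sigma (x i) /\ sigma (y i)) /\
        v = \sum_(i < m) c i *: (iota (x i) - iota (y i)),
      forall x y, tau x -> tau y -> dot (iota x - iota y) v = 0,
      dot v v = 1 &
      exists x y, sigma x /\ tau y /\ 0 < dot (iota x - iota y) v].

Definition vnormal (sigma tau : set X) : 'rV[R]_n := xget 0 (normal_vec sigma tau).

Definition slope (f : X -> R) (V sigma : set X) : 'rV[R]_n :=
  xget 0 [set w | forall x, sigma x -> V x -> f x = dot (iota x) w].

Definition cofaces (Pi : set (set X)) (V : set X) (k : nat) (tau : set X) :=
  [set sigma | restr_dim Pi V k.+1 sigma /\ is_face sigma tau].

Definition minkowski (Pi : set (set X)) (V : set X) (k : nat) (c : set X -> R) :=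
  forall tau, restr_dim Pi V k tau ->
    \sum_(sigma \in cofaces Pi V k tau) c sigma *: vnormal sigma tau = 0.

Definition positive_weight (Pi : set (set X)) (V : set X) (k : nat) (c : set X -> R) :=
  forall sigma, restr_dim Pi V k.+1 sigma -> 0 <= c sigma.

Definition fdot (Pi : set (set X)) (V : set X) (k : nat) (f : X -> R)
    (c : set X -> R) (tau : set X) : R :=
  - \sum_(sigma \in cofaces Pi V k tau) c sigma * dot (slope f V sigma) (vnormal sigma tau).

Definition strictly_concave (Pi : set (set X)) (U : set X) (f : X -> R) : Prop :=
  (forall sigma, restr Pi U sigma -> affine_on f (sigma `&` U)) /\
  forall (k : nat) (tau : set X) (V : set X),
    restr_dim Pi U k tau -> open V -> V `<=` U -> tau `&` V !=set0 ->
    forall c : set X -> R,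
      positive_weight Pi V k c -> minkowski Pi V k c ->
      (exists sigma, cofaces Pi V k tau sigma /\ 0 < c sigma) ->
      0 < fdot Pi V k f c tau.

Definition regular (Pi : set (set X)) (U : set X) : Prop :=
  exists g : X -> R, strictly_concave Pi U g.

End Defs.

(* Main.v *)
(* On H_X = {dot y a = 1} an inequality dot y u <= b reads dot y (u - b a) <= 0.
   Let l_j be the finitely many functionals u - b a coming from the inequalities
   of the polyhedra meeting U, and f = - sum_j |l_j|. Then S(Pi, f) consists of the
   intersections of the polyhedra of Pi with the closed cells of the hyperplane
   arrangement (l_j = 0).
   For a Minkowski weight c at tau, each functional l_j not vanishing at a relative
   interior point p of tau has constant sign near p, so it contributes 0 to
   (f . c)(tau) by balancing; the other l_j contribute nonnegative terms. A polyhedron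
   sigma with facet tau contributes strictly, for otherwise all constraints active at
   p would be active on sigma, and sigma would be contained in tau. *)
Require Import Defs.
From HB Require Import structures.
From mathcomp Require Import all_boot all_order all_algebra.
From mathcomp Require Import all_classical all_reals all_analysis.
From mathcomp Require Import ring lra.
Set Implicit Arguments.
Unset Strict Implicit.
Import Order.TTheory GRing.Theory Num.Theory.
Import numFieldNormedType.Exports.
Local Open Scope classical_set_scope.
Local Open Scope ring_scope.

(** * The inner product, short segments, and solution sets of linear inequalities *)

Section Dot.
Context {R : realType} {n : nat}.
Implicit Types (x y z u : 'rV[R]_n) (c : R).

Lemma dotC x y : dot x y = dot y x.
Proof. by apply: eq_bigr => j _; rewrite mulrC. Qed.

Lemma dotDl x y z : dot (x + y) z = dot x z + dot y z.
Proof. by rewrite -big_split; apply: eq_bigr => j _; rewrite mxE mulrDl. Qed.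

Lemma dotZl c x z : dot (c *: x) z = c * dot x z.
Proof. by rewrite mulr_sumr; apply: eq_bigr => j _; rewrite mxE mulrA. Qed.

Lemma dotNl x z : dot (- x) z = - dot x z.
Proof. by rewrite -scaleN1r dotZl mulN1r. Qed.

Lemma dotBl x y z : dot (x - y) z = dot x z - dot y z.
Proof. by rewrite dotDl dotNl. Qed.

Lemma dot0l z : dot 0 z = 0.
Proof. by rewrite -(scale0r 0) dotZl mul0r. Qed.

Lemma dotDr x y z : dot z (x + y) = dot z x + dot z y.
Proof. by rewrite !(dotC z) dotDl. Qed.

Lemma dotZr c x z : dot z (c *: x) = c * dot z x.
Proof. by rewrite !(dotC z) dotZl. Qed.

Lemma dotNr x z : dot z (- x) = - dot z x.
Proof. by rewrite !(dotC z) dotNl. Qed.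

Lemma dotBr x y z : dot z (x - y) = dot z x - dot z y.
Proof. by rewrite dotDr dotNr. Qed.

Lemma dot0r z : dot z 0 = 0.
Proof. by rewrite dotC dot0l. Qed.

Lemma dot_suml I (r : seq I) (P : pred I) (F : I -> 'rV[R]_n) z :
  dot (\sum_(i <- r | P i) F i) z = \sum_(i <- r | P i) dot (F i) z.
Proof. by elim/big_rec2: _ => [|i x y _ <-]; rewrite ?dot0l ?dotDl. Qed.

Lemma dot_sumr I (r : seq I) (P : pred I) (F : I -> 'rV[R]_n) z :
  dot z (\sum_(i <- r | P i) F i) = \sum_(i <- r | P i) dot z (F i).
Proof. by rewrite dotC dot_suml; apply: eq_bigr => i _; rewrite dotC. Qed.

Lemma dot_ge0 x : 0 <= dot x x.
Proof. by apply: sumr_ge0 => j _; rewrite -expr2 sqr_ge0. Qed.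

Lemma dot_eq0 x : dot x x = 0 -> x = 0.
Proof.
move=> x0; apply/rowP => j; rewrite mxE.
have sq_ge0 (i : 'I_n) : true -> 0 <= x ord0 i * x ord0 i.
  by move=> _; rewrite -expr2 sqr_ge0.
by have /eqP := psumr_eq0P sq_ge0 x0 (i := j) isT; rewrite mulf_eq0 orbb => /eqP.
Qed.

Lemma dotE x y : dot x y = (x *m y^T) ord0 ord0.
Proof. by rewrite mxE; apply: eq_bigr => j _; rewrite mxE. Qed.

Lemma continuous_dot u : continuous (fun y => dot y u).
Proof.
apply: continuous_big => [|j _]; first exact: add_continuous.
move=> y; apply: (@continuousM _ _ (fun z : 'rV[R]_n => z ord0 j) (fun=> u ord0 j)).
  exact: coord_continuous.
exact: cst_continuous.
Qed.

Lemma nbhs_segment x u (O : set 'rV[R]_n) : nbhs x O ->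
  \forall e \near (0 : R)^'+, O (x + e *: u).
Proof.
move=> /nbhs_ballP[r /= r_gt0 rO].
suff near_j : \forall e \near (0 : R)^'+, forall j, `|e * u ord0 j| < r.
  near=> e; apply: rO; split=> // i j.
  rewrite ord1 mxE /ball /= opprD addNKr normrN mxE.
  by move: j; near: e.
apply: filter_forall => j.
(* The summand [1] keeps the divisor positive when the coordinate of [u] vanishes. *)
have d_gt0 : 0 < 1 + `|u ord0 j| by rewrite ltr_pwDl.
near=> e.
have e_gt0 : 0 < e by near: e; exact: nbhs_right_gt.
have : e < r / (1 + `|u ord0 j|).
  by near: e; apply: nbhs_right_lt; rewrite divr_gt0.
rewrite ltr_pdivlMr// normrM gtr0_norm//; lra.
Unshelve. all: by end_near.
Qed.

(** Any finite index type is allowed, so that the constraints of a cell can be indexed by a sum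
    type. *)
Definition solutions {I : finType} (u : I -> 'rV[R]_n) (b : I -> R) : set 'rV[R]_n :=
  [set y | forall i, dot y (u i) <= b i].

Lemma solutions_polyhedron {I : finType} (u : I -> 'rV[R]_n) (b : I -> R) :
  is_polyhedron (solutions u b).
Proof.
exists #|I|, (u \o enum_val), (b \o enum_val).
apply/seteqP; split=> y yub i /=; first exact: yub.
by have := yub (enum_rank i); rewrite /= enum_rankK.
Qed.

Lemma solutions_closed {I : finType} (u : I -> 'rV[R]_n) (b : I -> R) :
  closed (solutions u b).
Proof.
have -> : solutions u b = \bigcap_(i in setT) ((fun y => dot y (u i)) @^-1` [set t | t <= b i]).
  by apply/seteqP; split=> y yub i; [move=> _|]; exact: yub.
apply: closed_bigI => i _; apply: closed_comp; last exact: closed_le.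
by move=> y _; exact: continuous_dot.
Qed.

Lemma solutions_convex {I : finType} (u : I -> 'rV[R]_n) (b : I -> R) x y t :
  solutions u b x -> solutions u b y -> 0 <= t <= 1 ->
  solutions u b (t *: x + (1 - t) *: y).
Proof.
move=> xub yub t01 i; rewrite dotDl !dotZl.
by have := xub i; have := yub i; nra.
Qed.

(* The constraints active at [p] stay satisfied because they are active at [x]
   as well; the inactive ones have some slack. *)
Lemma solutions_extend {I : finType} (u : I -> 'rV[R]_n) (b : I -> R) p x :
  solutions u b p -> (forall i, dot p (u i) = b i -> dot x (u i) = b i) ->
  exists2 e, 0 < e & solutions u b (p + e *: (p - x)).
Proof.
move=> pub px.
suff : \forall e \near 0^'+, solutions u b (p + e *: (p - x)).
  move=> nearub; near (0 : R)^'+ => e; exists e; first by near: e; exact: nbhs_right_gt.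
  by near: e.
apply: filter_forall => i.
have := pub i; rewrite le_eqVlt => /orP[/eqP pi|pi].
  near=> e; rewrite dotDl dotZl dotBl (px i pi) pi; lra.
have d_gt0 : 0 < 1 + `|dot (p - x) (u i)| by rewrite ltr_pwDl.
near=> e.
have e_gt0 : 0 < e by near: e; exact: nbhs_right_gt.
have : e <= (b i - dot p (u i)) / (1 + `|dot (p - x) (u i)|).
  by near: e; apply: nbhs_right_le; rewrite divr_gt0 ?subr_gt0.
rewrite ler_pdivlMr// (dotDl p (e *: _)) dotZl => le_e.
have : e * dot (p - x) (u i) <= e * (1 + `|dot (p - x) (u i)|).
  by rewrite ler_pM2l // (le_trans (ler_norm _)) // lerDr.
lra.
Unshelve. all: by end_near.
Qed.

End Dot.

(** * Affine dimension and unit normals of facets *)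

Section Dimension.
Context {R : realType} {n : nat} {X : topologicalType}.
Variable iota : X -> 'rV[R]_n.
Implicit Types (S T : set X) (v l : 'rV[R]_n).

Lemma subrBB (V : zmodType) (o x y : V) : (x - o) - (y - o) = x - y.
Proof. by rewrite opprB addrA subrK. Qed.

Definition diffs {k} (p : 'I_k.+1 -> X) : 'M[R]_(k, n) :=
  \matrix_(i < k) (iota (p (lift ord0 i)) - iota (p ord0)).

Lemma aff_indepE k (p : 'I_k.+1 -> X) : aff_indep (iota \o p) = row_free (diffs p).
Proof. by congr row_free; apply/matrixP => i j; rewrite !mxE. Qed.

Lemma diffs_sub k (p : 'I_k.+1 -> X) m (B : 'M[R]_(m, n)) :
  (forall i, (iota (p (lift ord0 i)) - iota (p ord0) <= B)%MS) -> (diffs p <= B)%MS.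
Proof. by move=> pB; apply/row_subP => i; rewrite rowK. Qed.

(** The new point goes to the last index, so the base point stays [p ord0]. The row space of [diffs]
    grows strictly, which forces full rank. *)
Lemma aff_indep_extend k (p : 'I_k.+1 -> X) x :
  aff_indep (iota \o p) -> ~~ (iota x - iota (p ord0) <= diffs p)%MS ->
  aff_indep (iota \o (fun i => if unlift ord_max i is Some j then p j else x)).
Proof.
set q := fun i => _; rewrite !aff_indepE => /eqP rk_p xNp.
have q_lift j : q (lift ord_max j) = p j by rewrite /q liftK.
have q0 : q ord0 = p ord0.
  by rewrite -q_lift; congr q; apply: ord_inj.
have p_sub : (diffs p <= diffs q)%MS.
  apply: diffs_sub => i.
  have <- : row (lift ord_max i) (diffs q) = iota (p (lift ord0 i)) - iota (p ord0).
    rewrite rowK q0 -(q_lift (lift ord0 i)); congr (iota (q _) - _); apply: ord_inj.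
    by rewrite lift0 !lift_max lift0.
  exact: row_sub.
have x_sub : (iota x - iota (p ord0) <= diffs q)%MS.
  have <- : row ord_max (diffs q) = iota x - iota (p ord0).
    rewrite rowK q0; congr (iota _ - _); rewrite /q.
    have -> : lift ord0 ord_max = ord_max :> 'I_k.+2 by apply: ord_inj.
    by rewrite unlift_none.
  exact: row_sub.
rewrite /row_free eqn_leq rank_leq_row -[X in (X < _)%N]rk_p.
by apply: rank_ltmx; rewrite ltmxE p_sub; apply: contra xNp; apply: submx_trans.
Qed.

(** A point of [S] outside the span would extend [p] to [k.+2] independent points, against
    maximality. *)
Lemma has_dim_span S k : has_dim iota S k ->
  exists p : 'I_k.+1 -> X, [/\ forall i, S (p i), \rank (diffs p) = k &
    forall x, S x -> (iota x - iota (p ord0) <= diffs p)%MS].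
Proof.
move=> [[p [Sp p_indep]] maxS]; exists p; split=> //.
  by apply/eqP; rewrite -[_ == _]/(row_free _) -aff_indepE.
move=> x Sx; apply: contrapT => /negP /(aff_indep_extend p_indep) q_indep.
by apply: maxS q_indep => i; case: unlift.
Qed.

Lemma has_dim_not_sub S T k : has_dim iota S k.+1 -> has_dim iota T k -> ~ S `<=` T.
Proof. by move=> [[p [Sp +]] _] [_ maxT] ST => /maxT; apply=> i; exact: ST. Qed.

Definition orthogonal_to T v := forall x y, T x -> T y -> dot (iota x - iota y) v = 0.

Lemma diffs_orthogonal k (p : 'I_k.+1 -> X) T v w :
  (forall i, T (p i)) -> orthogonal_to T v -> (w <= diffs p)%MS -> dot w v = 0.
Proof.
move=> Tp Tv /submxP[r ->]; rewrite mulmx_sum_row dot_suml big1// => i _.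
by rewrite dotZl rowK Tv ?mulr0.
Qed.

(** Orthogonal projection to the row space; the Gram matrix [A *m A^T] is invertible because
    [v *m A *m A^T = 0] forces [v *m A] to have norm 0. *)
Lemma orthogonal_part m (A : 'M[R]_(m, n)) (z : 'rV[R]_n) : row_free A ->
  exists2 w, (w <= A)%MS & forall i, dot (row i A) (z - w) = 0.
Proof.
move=> freeA.
have AAunit : A *m A^T \in unitmx.
  rewrite -row_free_unit; apply: inj_row_free => v vAA.
  apply: (row_free_inj freeA); rewrite mul0mx; apply: dot_eq0.
  by rewrite dotE trmx_mul !mulmxA -(mulmxA v) vAA mul0mx mxE.
exists (z *m A^T *m invmx (A *m A^T) *m A); first exact: submxMl.
move=> i; set w := _ *m A; have wA : (z - w) *m A^T = 0.
  by rewrite mulmxBl /w -!mulmxA mulVmx // mulmx1 subrr.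
have := congr1 (fun B : 'rV[R]_m => B ord0 i) wA; rewrite [X in _ = X]mxE => <-.
by rewrite dotC mxE; apply: eq_bigr => j _; rewrite !mxE.
Qed.

(** The rows of [A] span the directions of [T]. Some point of [S] lies outside the affine span of
    [T]; its offset from [p ord0], minus the projection to [A], is [e]. As the dimensions differ by
    one, [A] and [e] span the directions of [S]. *)
Lemma facet_direction S T k :
  has_dim iota S k.+1 -> has_dim iota T k -> T `<=` S ->
  exists m (A : 'M[R]_(m, n)) (e : 'rV[R]_n),
    [/\ forall v w, orthogonal_to T v -> (w <= A)%MS -> dot w v = 0,
        forall x y, S x -> S y -> exists c, (iota x - iota y - c *: e <= A)%MS,
        orthogonal_to T e,
        exists x y, [/\ S x, T y & 0 < dot (iota x - iota y) e] &
        exists h (c : 'I_h -> R) (x y : 'I_h -> X),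
          (forall i, S (x i) /\ S (y i)) /\
          e = \sum_(i < h) c i *: (iota (x i) - iota (y i))].
Proof.
move=> /has_dim_span[q [Sq rk_q q_span]] /has_dim_span[p [Tp rk_p p_span]] TS.
have q_spanB x y : S x -> S y -> (iota x - iota y <= diffs q)%MS.
  move=> Sx Sy; rewrite -(subrBB (iota (q ord0))).
  by rewrite addmx_sub // ?eqmx_opp q_span.
have p_sub_q : (diffs p <= diffs q)%MS.
  by apply: diffs_sub => i; apply: q_spanB; apply: TS.
have [x Sx xNp] : exists2 x, S x & ~~ (iota x - iota (p ord0) <= diffs p)%MS.
  apply: contrapT => noS; suff /mxrankS : (diffs q <= diffs p)%MS.
    by rewrite rk_q rk_p ltnn.
  have S_sub x : S x -> (iota x - iota (p ord0) <= diffs p)%MS.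
    by move=> Sx; apply: contrapT => /negP xNp; apply: noS; exists x.
  apply: diffs_sub => i; rewrite -(subrBB (iota (p ord0))).
  by rewrite addmx_sub // ?eqmx_opp S_sub.
have free_p : row_free (diffs p) by apply/eqP.
set z := iota x - iota (p ord0) in xNp *.
have [w w_sub w_orth] := orthogonal_part z free_p.
have orth_sub v : (v <= diffs p)%MS -> dot v (z - w) = 0.
  move=> /submxP[r ->]; rewrite mulmx_sum_row dot_suml big1// => i _.
  by rewrite dotZl w_orth mulr0.
have e_orth : orthogonal_to T (z - w).
  move=> y y' Ty Ty'; apply: orth_sub; rewrite -(subrBB (iota (p ord0))).
  by rewrite addmx_sub // ?eqmx_opp p_span.
have e_neq0 : z - w != 0.
  by apply: contra xNp => /eqP/subr0_eq ->.
have e_gt0 : 0 < dot (z - w) (z - w).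
  rewrite lt_neqAle dot_ge0 andbT eq_sym; apply: contra e_neq0.
  by move=> /eqP/dot_eq0 ->.
(* A rank count: the right side lies in [diffs q], of rank [k.+1], and strictly contains [diffs p],
   of rank [k]. *)
have span_q : (diffs q <= diffs p + z)%MS.
  have pz_sub : (diffs p + z <= diffs q)%MS.
    by rewrite addsmx_sub p_sub_q q_spanB //; apply: TS.
  rewrite -(mxrank_leqif_sup pz_sub) rk_q eqn_leq -[X in (_ <= X)%N && _]rk_q mxrankS //=.
  rewrite -[X in (X < _)%N]rk_p; apply: rank_ltmx; rewrite ltmxE addsmxSl.
  by apply: contra xNp; rewrite addsmx_sub => /andP[].
exists k, (diffs p), (z - w); split=> //.
- by move=> v v'; exact: diffs_orthogonal Tp.
- move=> y y' Sy Sy'.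
  have /sub_addsmxP[[r c] /= ->] := submx_trans (q_spanB _ _ Sy Sy') span_q.
  exists (c ord0 ord0); rewrite [c]mx11_scalar mul_scalar_mx !mxE mulr1n (scalerBr _ z w) opprB.
  rewrite -addrA [c ord0 ord0 *: z + _]addrC subrK.
  by rewrite addmx_sub ?submxMl// scalemx_sub.
- exists x, (p ord0); split=> //; rewrite -/z.
  by rewrite -[X in dot X _](subrK w) dotDl (orth_sub w)// addr0.
- have /submxP[r wE] := w_sub.
  (* Index 0 carries [z] with coefficient 1; the other [k] indices carry the expansion of [- w] in
     the rows of [diffs p]. *)
  exists k.+1, (fun i => if unlift ord0 i is Some j then - r ord0 j else 1),
    (fun i => if unlift ord0 i is Some j then p (lift ord0 j) else x), (fun=> p ord0).
  split=> [i|]; first by split; [case: unlift => // j |]; apply: TS.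
  rewrite big_ord_recl unlift_none scale1r; congr (_ + _).
  rewrite wE mulmx_sum_row -sumrN; apply: eq_bigr => i _.
  by rewrite liftK rowK scaleNr.
Qed.

(** The normalised [e] shows that a normal vector exists, so the choice made by [vnormal] is one.
    Modulo the directions of [T], those of [S] form a line, so a functional constant on [T] sees
    only the component along the normal. *)
Lemma vnormalP S T k :
  has_dim iota S k.+1 -> has_dim iota T k -> T `<=` S ->
  normal_vec iota S T (vnormal iota S T) /\
  forall l, orthogonal_to T l -> forall x y, S x -> T y ->
    dot (iota x - iota y) l =
      dot (iota x - iota y) (vnormal iota S T) * dot (vnormal iota S T) l.
Proof.
move=> dimS dimT TS.
have [m [A [e [orthA spanS Te [x [y [Sx Ty xye]]] e_comb]]]] := facet_direction dimS dimT TS.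
have e_gt0 : 0 < dot e e.
  rewrite lt_neqAle dot_ge0 andbT; apply/eqP => /esym/dot_eq0 e0.
  by move: xye; rewrite e0 dot0r ltxx.
have vP : normal_vec iota S T (vnormal iota S T).
  apply: xgetPex; set d := Num.sqrt (dot e e).
  have d_gt0 : 0 < d by rewrite sqrtr_gt0.
  exists (d^-1 *: e); split.
  - have [h [c [x' [y' [S' eE]]]]] := e_comb.
    exists h, (fun i => d^-1 * c i), x', y'; split=> //.
    by rewrite {1}eE scaler_sumr; apply: eq_bigr => i _; rewrite scalerA.
  - by move=> x' y' Tx' Ty'; rewrite dotZr Te ?mulr0.
  - rewrite dotZl dotZr -(sqr_sqrtr (dot_ge0 e)) -/d expr2; field.
    exact: lt0r_neq0.
  - by exists x, y; split=> //; split=> //; rewrite dotZr mulr_gt0 ?invr_gt0.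
split=> // l Tl x' y' Sx' Ty'.
set v := vnormal iota S T in vP *.
have [[h [c [x0 [y0 [S0 vE]]]]] Tv v1 _] := vP.
have [r vr] : exists r, (v - r *: e <= A)%MS.
  pose t i := projT1 (cid (spanS _ _ (S0 i).1 (S0 i).2)).
  exists (\sum_i c i * t i).
  rewrite {1}vE scaler_suml -sumrB summx_sub// => i _.
  rewrite -scalerA -scalerBr scalemx_sub// /t; case: cid => //.
(* The remainder [v - r *: e] is a direction of [T] and orthogonal to all of these, hence to
   itself. *)
have v_e : v = r *: e.
  apply/subr0_eq/dot_eq0.
  by rewrite [X in dot _ X = _]/(_ - _) dotBr (orthA _ _ Tv vr) dotZr (orthA _ _ Te vr) mulr0 subrr.
have [c0 cA] := spanS _ _ Sx' (TS _ Ty').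
have dotE_c l' : orthogonal_to T l' -> dot (iota x' - iota y') l' = c0 * dot e l'.
  by move=> Tl'; rewrite -[X in dot X _](subrK (c0 *: e)) dotDl (orthA _ _ Tl' cA) add0r dotZl.
rewrite !dotE_c// v_e dotZl dotZr.
have : r * r * dot e e = 1 by rewrite -v1 v_e dotZl dotZr mulrA.
by move=> re; rewrite -[LHS]mul1r -re; ring.
Qed.

End Dimension.

(** * Relative interior points and faces *)

Section Faces.
Context {R : realType} {n : nat} {X : topologicalType}.
Variable iota : X -> 'rV[R]_n.
Implicit Types (S T : set X).

(** A substitute for convexity that suffices for finding relative interior points, stated on
    functionals as it is applied. *)
Definition midpoint_closed T := forall x y, T x -> T y ->
  exists2 z, T z & forall u, dot (iota z) u = (dot (iota x) u + dot (iota y) u) / 2.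

Lemma solutions_midpoint {I : finType} (u : I -> 'rV[R]_n) b T :
  iota @` T = solutions u b -> midpoint_closed T.
Proof.
move=> TE x y Tx Ty.
have half01 : 0 <= (2^-1 : R) <= 1 by lra.
have sol z : T z -> solutions u b (iota z) by rewrite -TE; exists z.
have := solutions_convex (sol _ Tx) (sol _ Ty) half01.
rewrite -TE => -[z Tz zE]; exists z => // v.
rewrite zE dotDl !dotZl; lra.
Qed.

Lemma face_midpoint S T : is_face iota S T -> midpoint_closed S -> midpoint_closed T.
Proof.
move=> [u [b [Sub ->]]] midS x y [Sx xu] [Sy yu].
have [z Sz zE] := midS _ _ Sx Sy; exists z => //.
by split=> //; rewrite zE xu yu; lra.
Qed.

(** Treat the constraints one at a time: if some [x] in [T] makes one strict, replace [p] by the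
    midpoint of [p] and [x]. A constraint tight at a midpoint is tight at both ends, so earlier
    progress is kept. *)
Lemma exists_relint {I : finType} (u : I -> 'rV[R]_n) b T :
  midpoint_closed T -> T !=set0 -> (forall x, T x -> solutions u b (iota x)) ->
  exists2 p, T p & forall i, dot (iota p) (u i) = b i ->
    forall x, T x -> dot (iota x) (u i) = b i.
Proof.
move=> midT [x0 Tx0] Tub.
suff [p Tp p_relint] : exists2 p, T p & forall i, i \in enum I ->
    dot (iota p) (u i) = b i -> forall x, T x -> dot (iota x) (u i) = b i.
  by exists p => // i; apply: p_relint; rewrite mem_enum.
elim: (enum I) => [|i r [p Tp p_relint]]; first by exists x0.
have [all_i|/existsNP[x /not_implyP[Tx xi]]] :=
    pselect (forall x, T x -> dot (iota x) (u i) = b i).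
  by exists p => // j; rewrite inE => /orP[/eqP -> //|]; apply: p_relint.
have [z Tz zE] := midT _ _ Tp Tx; exists z => // j.
have p_le := Tub _ Tp j; have x_le := Tub _ Tx j.
rewrite inE zE => /orP[/eqP ji|jr] zj.
  by case: xi; rewrite -ji; lra.
by apply: p_relint => //; lra.
Qed.

(** From [p] one can move a little away from [x] inside [S]. The functional exposing [T] is maximal
    at [p], hence constant on the segment, up to [x]. *)
Lemma face_of_active {I : finType} (u : I -> 'rV[R]_n) b S T p x :
  iota @` S = solutions u b -> is_face iota S T -> T p -> S x ->
  (forall i, dot (iota p) (u i) = b i -> dot (iota x) (u i) = b i) -> T x.
Proof.
move=> SE [w [c [Sw ->]]] [Sp pw] Sx px; split=> //.
have : solutions u b (iota p) by rewrite -SE; exists p.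
move=> /solutions_extend /(_ px)[e e_gt0]; rewrite -SE => -[z Sz zE].
have := Sw _ Sz; rewrite zE dotDl dotZl dotBl pw => le_c.
by apply/le_anti; rewrite Sw //=; nra.
Qed.

Lemma empty_face S : is_face iota S set0.
Proof.
exists 0, 1; split=> [x _|]; first by rewrite dot0r.
by apply/seteqP; split=> x //= [_]; rewrite dot0r => /eqP; rewrite eq_sym oner_eq0.
Qed.

Lemma complex_solutions (Pi : set (set X)) S : is_complex iota Pi -> Pi S ->
  exists q (u : 'I_q -> 'rV[R]_n) (b : 'I_q -> R), iota @` S = solutions u b.
Proof. by move=> [_ [_ [cPi _]]] /cPi[_ _ [q [u [b SE]]] _ _]; exists q, u, b. Qed.

End Faces.

(** * Cells of the arrangement inside the polyhedra, and their identification with [S_of] *)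

Section Arrangement.
Context {R : realType} {n m : nat} {X : topologicalType}.
Variables (iota : X -> 'rV[R]_n) (l : 'I_m -> 'rV[R]_n).
Implicit Types (S T : set X) (s t : {ffun 'I_m -> option bool}).

(** Encoding the three signs by [option bool] makes the sign vectors a finite type. *)
Definition sg (o : option bool) : R :=
  match o with Some true => 1 | Some false => -1 | None => 0 end.

(* [sg (s j) * r = `|r|] says that [r] is nonnegative, nonpositive or zero
   according to [s j]: this is the closed cell of sign vector [s]. *)
Definition cell S s : set X := [set x | S x /\
  forall j, sg (s j) * dot (iota x) (l j) = `|dot (iota x) (l j)|].

Definition bend x : R := - \sum_j `|dot (iota x) (l j)|.

Definition cell_slope s : 'rV[R]_n := - \sum_j sg (s j) *: l j.

Lemma sg_le o r : sg o * r <= `|r|.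
Proof.
case: o => [[]|] /=; rewrite ?mul1r ?mulN1r ?mul0r//; first exact: ler_norm.
by rewrite -normrN ler_norm.
Qed.

(** Turns the sign condition of a cell into the two linear inequalities [r <= sg o * r] and
    [- r <= sg o * r], so that cells are polyhedra. *)
Lemma sg_abs o (r : R) :
  sg o * r = `|r| <-> forall c : bool, ((-1) ^+ c - sg o) * r <= 0.
Proof.
split=> [sgr c|sgr].
  rewrite mulrBl sgr subr_le0; case: c; rewrite ?expr0 ?expr1 ?mul1r ?mulN1r.
    by rewrite -normrN ler_norm.
  exact: ler_norm.
apply/le_anti; rewrite sg_le /= ler_norml.
have := sgr true; have := sgr false; rewrite expr0 expr1; lra.
Qed.

Lemma dot_cell_slope x s :
  dot (iota x) (cell_slope s) = - \sum_j sg (s j) * dot (iota x) (l j).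
Proof. by rewrite dotNr dot_sumr; under eq_bigr do rewrite dotZr. Qed.

Lemma bend_le x s : bend x <= dot (iota x) (cell_slope s).
Proof. by rewrite dot_cell_slope lerN2; apply: ler_sum => j _; exact: sg_le. Qed.

(** No summand of the signed sum exceeds its absolute value, so equal sums force equality term by
    term. With [bend_le], [cell_slope s] touches [bend] exactly where the sign conditions hold. *)
Lemma bend_eq x s : bend x = dot (iota x) (cell_slope s) <->
  forall j, sg (s j) * dot (iota x) (l j) = `|dot (iota x) (l j)|.
Proof.
rewrite dot_cell_slope /bend; split=> [/oppr_inj eq_sum j|eq_sg]; last first.
  by congr (- _); apply: eq_bigr => j _; rewrite eq_sg.
have gap_ge0 i : true -> 0 <= `|dot (iota x) (l i)| - sg (s i) * dot (iota x) (l i).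
  by move=> _; rewrite subr_ge0 sg_le.
have gap0 : \sum_i (`|dot (iota x) (l i)| - sg (s i) * dot (iota x) (l i)) = 0.
  by rewrite sumrB eq_sum subrr.
by have /eqP := psumr_eq0P gap_ge0 gap0 (i := j) isT; rewrite subr_eq0 => /eqP.
Qed.

Lemma cell_bend S s x : cell S s x -> bend x = dot (iota x) (cell_slope s).
Proof. by move=> [_ ?]; apply/bend_eq. Qed.

Section CellConstraints.
Context {I : finType} (u : I -> 'rV[R]_n) (b : I -> R) (s : {ffun 'I_m -> option bool}).

Definition cell_normal (i : I + 'I_m * bool) : 'rV[R]_n :=
  match i with
  | inl i => u i
  | inr (j, c) => ((-1) ^+ (c : nat) - sg (s j)) *: l j
  end.

Definition cell_bound (i : I + 'I_m * bool) : R := if i is inl i then b i else 0.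

Lemma cell_solutions S : iota @` S = solutions u b ->
  iota @` (cell S s) = solutions cell_normal cell_bound.
Proof.
move=> SE; apply/seteqP; split=> [_ [x [Sx xs] <-] [i|[j c]] /=|y ysol].
- have : solutions u b (iota x) by rewrite -SE; exists x.
  exact.
- by rewrite dotZr; have /sg_abs := xs j; exact.
- have : solutions u b y by move=> i; exact: (ysol (inl i)).
  rewrite -SE => -[x Sx xy]; exists x => //; split=> // j.
  by apply/sg_abs => c; have := ysol (inr (j, c)); rewrite /= dotZr xy.
Qed.

End CellConstraints.

Section Complex.
Variable Pi : set (set X).
Hypothesis Pi_complex : is_complex iota Pi.

Lemma cell_midpoint S s : Pi S -> midpoint_closed iota (cell S s).
Proof.
move=> /(complex_solutions Pi_complex)[q [u [b SE]]].
exact: solutions_midpoint (cell_solutions s SE).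
Qed.

Lemma complex_face S T : Pi S -> is_face iota S T -> Pi T.
Proof. by case: Pi_complex => _ [_ [cPi _]] /cPi[_ _ _ _]; exact. Qed.

(** Take a relative interior point [p] of the face. The face is the cell obtained by shrinking [S]
    to the constraints tight at [p] and setting to [None] the signs of the functionals vanishing at
    [p]. *)
Lemma cell_face S s T : Pi S -> is_face iota (cell S s) T ->
  exists S' s', Pi S' /\ T = cell S' s'.
Proof.
move=> PiS faceT.
(* The empty face has no interior point; it is a cell of the empty polyhedron, itself a face of
   [S]. *)
have [T0|T0] := pselect (T = set0).
  exists set0, s; split; first exact: complex_face PiS (empty_face _ _).
  by rewrite T0; apply/seteqP; split=> x // -[].
have [q [u [b SE]]] := complex_solutions Pi_complex PiS.
have cellE := cell_solutions s SE.
have TS : T `<=` cell S s by case: faceT => w [c [_ ->]] x [].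
have [p Tp p_relint] : exists2 p, T p & forall i,
    dot (iota p) (cell_normal u s i) = cell_bound b i ->
    forall x, T x -> dot (iota x) (cell_normal u s i) = cell_bound b i.
  apply: exists_relint; last by move=> x /TS ?; rewrite -cellE; exists x.
    exact: face_midpoint faceT (cell_midpoint PiS).
  by apply/set0P/eqP.
have [Sp ps] := TS _ Tp.
pose S' := [set x | S x /\ forall i, dot (iota p) (u i) = b i -> dot (iota x) (u i) = b i].
pose s' := [ffun j => if dot (iota p) (l j) == 0 then None else s j].
have s'_eq j x : dot (iota p) (l j) = 0 ->
    sg (s' j) * dot (iota x) (l j) = `|dot (iota x) (l j)| <-> dot (iota x) (l j) = 0.
  move=> pj; rewrite ffunE pj eqxx /= mul0r; split=> [/esym/normr0_eq0//|->].
  by rewrite normr0.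
have solS x : S x -> solutions u b (iota x) by rewrite -SE; exists x.
exists S', s'; split.
  apply: complex_face PiS _.
  (* The sum of the constraints tight at [p] exposes [S']: no term exceeds its bound, so a tight sum
     makes every term tight. *)
  exists (\sum_(i | dot (iota p) (u i) == b i) u i),
    (\sum_(i | dot (iota p) (u i) == b i) b i); split=> [x Sx|].
    by rewrite dot_sumr; apply: ler_sum => i _; exact: solS.
  apply/seteqP; split=> x /= [Sx].
    move=> px; split=> //; rewrite dot_sumr; apply: eq_bigr => i /eqP; exact: px.
  rewrite dot_sumr => /eqP; rewrite -subr_eq0 -opprB oppr_eq0 -sumrB => /eqP gap0.
  split=> // i /eqP pi; apply/eqP; rewrite eq_sym -subr_eq0; apply/eqP.
  by apply: (psumr_eq0P _ gap0) => // k _; rewrite subr_ge0; exact: solS.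
apply/seteqP; split=> [x Tx|x [[Sx xS'] xs']].
  have [Sx xs] := TS _ Tx; split.
    by split=> // i pi; exact: (p_relint (inl i) pi).
  move=> j; have [pj|pj] := eqVneq (dot (iota p) (l j)) 0.
    apply/s'_eq => //.
    (* Both inequalities of [l j] are tight at [p], hence on [T]; together they say that [l j]
       vanishes. *)
    have tight c : dot (iota x) (cell_normal u s (inr (j, c))) = 0.
      by apply: p_relint => //=; rewrite dotZr pj mulr0.
    have := tight true; have := tight false; rewrite /= !dotZr expr0 expr1; lra.
  by rewrite ffunE (negPf pj).
have s'j j : dot (iota p) (l j) != 0 -> s' j = s j by rewrite ffunE => /negPf ->.
have x_cell : cell S s x.
  split=> // j; have [pj|pj] := eqVneq (dot (iota p) (l j)) 0.
    by have /s'_eq -> := xs' j; rewrite ?mulr0 ?normr0.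
  by rewrite -s'j.
apply: (face_of_active cellE faceT Tp x_cell) => -[i|[j c]] /=; first exact: xS'.
rewrite !dotZr => /eqP; rewrite mulf_eq0 => /orP[/eqP ->|/eqP pj].
  by rewrite mul0r.
by have /s'_eq -> := xs' j; rewrite ?mulr0.
Qed.

(** A cell is cut out by its [cell_slope]. Conversely, where [bend] touches a linear [w] from below
    no [l j] changes sign, so [T] lies in a cell, and it is a face of that cell. *)
Lemma S_of_bend : S_of iota Pi bend = [set T | exists S s, Pi S /\ T = cell S s].
Proof.
apply/seteqP; split=> [T [S [PiS [TS [w [Tw Sw]]]]]|T [S [s [PiS ->]]]]; last first.
  exists S; split=> //; split=> [x []//|]; exists (cell_slope s).
  split=> [x|x Sx xNs]; first exact: cell_bend.
  rewrite lt_neqAle bend_le andbT; apply/eqP => xs; apply: xNs; split=> //.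
  exact/bend_eq.
have Sw_le x : S x -> bend x <= dot (iota x) w.
  move=> Sx; have [/Tw ->//|Tx] := pselect (T x); exact/ltW/Sw.
have [q [u [b SE]]] := complex_solutions Pi_complex PiS.
(* Between points where [l j] has opposite signs, the absolute value at the midpoint is strictly
   below the mean, so [bend] would exceed [w] there. *)
have half j : (forall x, T x -> 0 <= dot (iota x) (l j)) \/
              (forall x, T x -> dot (iota x) (l j) <= 0).
  apply: contrapT => /not_orP[/existsNP[y /not_implyP[Ty /negP]]].
  rewrite -ltNge => y_lt0 /existsNP[x /not_implyP[Tx /negP]]; rewrite -ltNge => x_gt0.
  have [z Sz zE] := solutions_midpoint SE (TS _ Tx) (TS _ Ty).
  have := Sw_le _ Sz; rewrite zE -(Tw _ Tx) -(Tw _ Ty) leNgt => /negP; apply.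
  have half_norm : `|2^-1 : R| = 2^-1 by rewrite gtr0_norm ?invr_gt0.
  rewrite /bend -opprD mulNr ltrN2 -big_split mulr_suml /=.
  rewrite (bigD1 j) //= [ltRHS](bigD1 j) //=; apply: ltr_leD.
    rewrite zE normrM (gtr0_norm x_gt0) (ltr0_norm y_lt0) half_norm ltr_pM2r ?invr_gt0//.
    by rewrite ltr_norml; apply/andP; split; lra.
  apply: ler_sum => i _; rewrite zE normrM half_norm ler_pM2r ?invr_gt0//.
  exact: ler_normD.
pose s := [ffun j => Some `[< forall x, T x -> 0 <= dot (iota x) (l j) >]].
have Ts : T `<=` cell S s.
  move=> x Tx; split=> [|j]; first exact: TS.
  rewrite ffunE; case: asboolP => /= [/(_ _ Tx)/ger0_norm ->|T_neg]; first by rewrite mul1r.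
  by have [//|/(_ _ Tx)/ler0_norm ->] := half j; rewrite mulN1r.
(* On the cell this functional is [bend - w], which is at most 0 and vanishes exactly on [T]. *)
apply: (cell_face (s := s) PiS); exists (cell_slope s - w), 0; split=> [x [Sx xs]|].
  by rewrite dotBr -(cell_bend (conj Sx xs)) subr_le0 Sw_le.
apply/seteqP; split=> [x Tx|x [[Sx xs] /eqP]].
  by split; [exact: Ts | rewrite dotBr -(cell_bend (Ts _ Tx)) Tw ?subrr].
rewrite dotBr -(cell_bend (conj Sx xs)) subr_eq0 => /eqP xw.
by apply: contrapT => /(Sw _ Sx); rewrite xw ltxx.
Qed.

End Complex.
End Arrangement.

(** * The cells form a polyhedral complex *)

Section Subdivision.
Context {R : realType} {n m : nat} {X : topologicalType}.
Variables (iota : X -> 'rV[R]_n) (l : 'I_m -> 'rV[R]_n) (Pi : set (set X)).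
Hypothesis Pi_complex : is_complex iota Pi.
Implicit Types (S T : set X) (s t : {ffun 'I_m -> option bool}).

Local Notation cell := (cell iota l).
Local Notation bend := (bend iota l).

Definition cells : set (set X) := [set T | exists S s, Pi S /\ T = cell S s].

Lemma cell_sub S s x : (cell S s x) -> S x. Proof. by case. Qed.

Lemma cells_finite (W : set X) : finite_set (restr Pi W) -> finite_set (restr cells W).
Proof.
move=> finPi.
have := finite_image (fun Ss : set X * {ffun 'I_m -> option bool} => cell Ss.1 Ss.2)
  (finite_setX finPi (@finite_finset _ setT)).
move=> fin_img; apply: sub_finite_set fin_img => _ [[S [s [PiS ->]]] [x [[Sx xs] Wx]]].
by exists (S, s) => //; split=> //; split=> //; exists x.
Qed.

Lemma cells_cover x : exists S, cells S /\ S x.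
Proof.
have [S [PiS Sx]] := Pi_complex.1 x.
pose s := [ffun j => Some (0 <= dot (iota x) (l j))].
exists (cell S s); split; first by exists S, s.
split=> // j; rewrite ffunE; case: leP => /= [/ger0_norm|/ltr0_norm] ->.
  by rewrite mul1r.
by rewrite mulN1r.
Qed.

(** Continuity of [iota] on [S] comes from the homeomorphism clause: the open set [O] where a sign
    condition fails pulls back to a relatively open subset of the closed set [S]. *)
Lemma cell_closed S s : Pi S -> closed (cell S s).
Proof.
case: Pi_complex => _ [_ [cPi _]] /cPi[clS injS _ homS _].
pose O : set 'rV[R]_n := ~` [set y | forall j, sg (s j) * dot y (l j) = `|dot y (l j)|].
have openO : open O.
  rewrite openC.
  have -> : [set y | forall j, sg (s j) * dot y (l j) = `|dot y (l j)|] =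
      solutions (fun i : 'I_m * bool => ((-1) ^+ (i.2 : nat) - sg (s i.1)) *: l i.1) (fun=> 0).
    apply/seteqP; split=> y /= ys => [[j c]|j].
      by rewrite dotZr; have /sg_abs := ys j; exact.
    by apply/sg_abs => c; have := ys (j, c); rewrite dotZr.
  exact: solutions_closed.
have [|V [openV VE]] := (homS (S `&` iota @^-1` O) (@subIsetl _ _ _)).2.
  exists O; split=> //; apply/seteqP; split=> [_ [x [Sx xO] <-]|_ [[x Sx <-] xO]].
    by split=> //; exists x.
  by exists x.
have -> : cell S s = S `&` ~` V.
  apply/seteqP; split=> x [Sx xs]; split=> //.
    by move=> Vx; have : (S `&` V) x by []; rewrite -VE => -[_]; apply.
  apply: contrapT => xO; apply: xs.
  by have : (S `&` iota @^-1` O) x by []; rewrite VE => -[].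
by apply: closedI => //; exact: open_closedC.
Qed.

Lemma cell_homeo S s A : Pi S -> A `<=` cell S s ->
  (exists O, open O /\ A = cell S s `&` O) <->
  (exists O : set 'rV[R]_n, open O /\ iota @` A = iota @` (cell S s) `&` O).
Proof.
case: Pi_complex => _ [_ [cPi _]] /cPi[_ injS _ homS _] AS.
split; case=> O [openO AE].
  have [|O' [openO' O'E]] := (homS (S `&` O) (@subIsetl _ _ _)).1; first by exists O.
  exists O'; split=> //; apply/seteqP; split=> [_ [x Ax <-]|_ [[x xs <-] xO']].
    have := Ax; rewrite AE => -[xs Ox]; split; first by exists x.
    have : (iota @` (S `&` O)) (iota x) by exists x => //; split=> //; exact: (cell_sub xs).
    by rewrite O'E => -[].
  have : (iota @` S `&` O') (iota x) by split=> //; exists x => //; exact: (cell_sub xs).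
  rewrite -O'E => -[y [Sy Oy] /(injS _ _ Sy (cell_sub xs)) yx].
  by exists x => //; rewrite AE -yx yx; split=> //; rewrite -yx.
have [|O' [openO' O'E]] := (homS (S `&` iota @^-1` O) (@subIsetl _ _ _)).2.
  exists O; split=> //; apply/seteqP; split=> [_ [x [Sx xO] <-]|_ [[x Sx <-] xO]].
    by split=> //; exists x.
  by exists x.
exists O'; split=> //; apply/seteqP; split=> [x Ax|x [xs xO']].
  have xs := AS _ Ax; split=> //.
  have : (iota @` A) (iota x) by exists x.
  rewrite AE => -[_ xO].
  have : (S `&` iota @^-1` O) x by split=> //; exact: (cell_sub xs).
  by rewrite O'E => -[].
have : (S `&` O') x by split=> //; exact: (cell_sub xs).
rewrite -O'E => -[Sx xO].
have : (iota @` cell S s `&` O) (iota x) by split=> //; exists x.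
by rewrite -AE => -[y Ay /(injS _ _ (cell_sub (AS _ Ay)) Sx) <-].
Qed.

(** A functional whose signs in [s] and [t] differ must vanish on the intersection. On [cell S s],
    [sg (s j) *: l j] evaluates to an absolute value; subtracting these for all such [j] from the
    functional exposing the common face of [S] and [T] exposes the intersection. *)
Lemma cell_inter_face S s T t : Pi S -> Pi T ->
  is_face iota (cell S s) (cell S s `&` cell T t).
Proof.
move=> PiS PiT; case: Pi_complex => _ [_ [_ /(_ _ _ PiS PiT)[[u [b [Sub STE]]] _]]].
pose D := [pred j | s j != t j].
exists (u - \sum_(j | D j) sg (s j) *: l j), b.
have dotE x : cell S s x -> dot (iota x) (u - \sum_(j | D j) sg (s j) *: l j) =
    dot (iota x) u - \sum_(j | D j) `|dot (iota x) (l j)|.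
  move=> [_ xs]; rewrite dotBr dot_sumr; congr (_ - _); apply: eq_bigr => j _.
  by rewrite dotZr xs.
split=> [x xs|].
  rewrite dotE // lerBlDr; apply: le_trans (Sub _ (cell_sub xs)) _.
  by rewrite lerDl; apply: sumr_ge0 => j _; exact: normr_ge0.
apply/seteqP; split=> [x [xs [Tx xt]]|x [xs]].
  split=> //; rewrite dotE// big1 ?subr0 => [|j /eqP stj].
    have : (S `&` T) x by split=> //; exact: (cell_sub xs).
    by rewrite STE => -[].
  have := xs.2 j; rewrite -xt => /eqP; rewrite -subr_eq0 -mulrBl mulf_eq0
    => /orP[|/eqP ->]; last by rewrite mulr0.
  suff -> : (sg (s j) - sg (t j) == 0 :> R) = false by [].
  by case: (s j) (t j) stj => [[]|] [[]|] //= _; apply/negP => /eqP; lra.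
rewrite dotE// => xb; split=> //.
have sum_ge0 : 0 <= \sum_(j | D j) `|dot (iota x) (l j)|.
  by apply: sumr_ge0 => j _; exact: normr_ge0.
have u_le := Sub _ (cell_sub xs).
have : (S `&` T) x by rewrite STE; split; [exact: cell_sub xs|lra].
move=> [_ Tx]; split=> // j.
have [stj|stj] := eqVneq (s j) (t j); first by rewrite -stj; exact: xs.2.
have sum0 : \sum_(j | D j) `|dot (iota x) (l j)| = 0 by lra.
have /normr0_eq0 -> := psumr_eq0P (fun k _ => normr_ge0 (dot (iota x) (l k))) sum0 (i := j) stj.
by rewrite mulr0 normr0.
Qed.

Lemma cells_complex : is_complex iota cells.
Proof.
have [_ [locfin [cPi _]]] := Pi_complex.
split; first exact: cells_cover.
split=> [x|].
  by have [W [xW finW]] := locfin x; exists W; split=> //; exact: cells_finite.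
split=> [_ [S [s [PiS ->]]]|_ _ [S [s [PiS ->]]] [T [t [PiT ->]]]]; last first.
  by split; [|rewrite setIC]; exact: cell_inter_face.
have [_ injS _ _ _] := cPi _ PiS; split.
- exact: cell_closed.
- by move=> x y /cell_sub Sx /cell_sub Sy; exact: injS.
- have [q [u [b SE]]] := complex_solutions Pi_complex PiS.
  by rewrite (cell_solutions l s SE); exact: solutions_polyhedron.
- by move=> A; exact: cell_homeo.
- by move=> T /(cell_face Pi_complex PiS).
Qed.

(** From a point of [V] a short step towards any point of [S] stays in [V], by the homeomorphism
    clause. Hence [slope], chosen by its values on part of [S], is determined on the directions of
    [S]. *)
Lemma affine_unique S V w w' : cells S -> open V -> S `&` V !=set0 ->
  (forall x, S x -> V x -> dot (iota x) w = dot (iota x) w') ->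
  forall x y, S x -> S y -> dot (iota x - iota y) w = dot (iota x - iota y) w'.
Proof.
move=> cS openV [p [Sp Vp]] ww'.
have [_ [_ [/(_ _ cS)[_ injS [q [u [b SE]]] homS _] _]]] := cells_complex.
have [|O [openO OE]] := (homS (S `&` V) (@subIsetl _ _ _)).1; first by exists V.
have sol z : S z -> solutions u b (iota z).
  by move=> Sz; have : (iota @` S) (iota z) by [exists z]; rewrite SE.
suff to_p x : S x -> dot (iota x - iota p) w = dot (iota x - iota p) w'.
  move=> x y Sx Sy; rewrite -(subrBB (iota p)) [LHS]dotBl [RHS]dotBl.
  by rewrite !to_p.
move=> Sx.
have nbhsO : nbhs (iota p) O.
  apply: open_nbhs_nbhs; split=> //.
  have : (iota @` (S `&` V)) (iota p) by exists p.
  by rewrite OE => -[].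
have nearO := nbhs_segment (iota x - iota p) nbhsO.
have [e [e_gt0 e_le1 eO]] : exists e : R, [/\ 0 < e, e <= 1 & O (iota p + e *: (iota x - iota p))].
  near (0 : R)^'+ => e; exists e; split.
  - by near: e; exact: nbhs_right_gt.
  - by near: e; exact: nbhs_right_le.
  - by near: e; exact: nearO.
have : (iota @` S `&` O) (iota p + e *: (iota x - iota p)).
  split=> //; rewrite SE.
  have e01 : 0 <= e <= 1 by rewrite e_le1 ltW.
  have := solutions_convex (sol _ Sx) (sol _ Sp) e01; congr solutions.
  by rewrite scalerBr scalerBl scale1r addrCA addrA.
rewrite -OE => -[z [Sz Vz] zE].
have := ww' _ Sz Vz; rewrite zE !(dotDl (iota p)) !dotZl (ww' _ Sp Vp).
by move=> /addrI; apply: mulfI; exact: lt0r_neq0.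
Unshelve. all: by end_near.
Qed.

End Subdivision.

(** * Strong and strict concavity of [bend] *)

Section StrictConcavity.
Context {R : realType} {n m : nat} {X : topologicalType}.
Variables (iota : X -> 'rV[R]_n) (l : 'I_m -> 'rV[R]_n) (Pi : set (set X)).
Variables (a : 'rV[R]_n) (U : set X).
Hypothesis Pi_complex : is_complex iota Pi.
Hypothesis iota_a : forall x, dot (iota x) a = 1.
Hypothesis finite_U : finite_set (restr Pi U).
Hypothesis l_bounds : forall S, restr Pi U S ->
  exists q (u : 'I_q -> 'rV[R]_n) (b : 'I_q -> R),
    iota @` S = solutions u b /\ forall i, exists j, l j = u i - b i *: a.

Local Notation cell := (cell iota l).
Local Notation cells := (cells iota l Pi).
Local Notation bend := (bend iota l).

Lemma bend_strongly_concave : strongly_concave iota a bend.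
Proof.
exists (fun y => (- \sum_j `|dot y (l j)|)%:E); split=> // y1 y2 t1 t2 lam _ _.
rewrite !lee_fin => t1_le t2_le lam_ge0 lam_le1.
have sum_le : \sum_j `|dot (lam *: y1 + (1 - lam) *: y2) (l j)| <=
    lam * (\sum_j `|dot y1 (l j)|) + (1 - lam) * (\sum_j `|dot y2 (l j)|).
  rewrite !mulr_sumr -big_split /=; apply: ler_sum => j _.
  rewrite dotDl !dotZl (le_trans (ler_normD _ _))// !normrM.
  by rewrite (ger0_norm lam_ge0) (@ger0_norm _ (1 - lam)) ?subr_ge0.
by move: (\sum_j _) (\sum_j _) (\sum_j _) t1_le t2_le sum_le => A B C; nra.
Qed.

Section Facet.
Variables (S T V : set X) (k : nat) (p : X).
Hypotheses (cS : cells S) (dimS : has_dim iota S k.+1) (dimT : has_dim iota T k).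
Hypotheses (openV : open V) (VU : V `<=` U) (SV : S `&` V !=set0).
Hypotheses (faceT : is_face iota S T) (Tp : T p).
Hypothesis p_relint : forall j, dot (iota p) (l j) = 0 ->
  forall x, T x -> dot (iota x) (l j) = 0.

Let v := vnormal iota S T.

Lemma face_subset : T `<=` S.
Proof. by case: faceT => u [b [_ ->]] x []. Qed.

(** The two slopes may differ as vectors, but [v] is a combination of differences of points of [S],
    where [affine_unique] applies. *)
Lemma slope_bend s S0 : S = cell S0 s -> dot (slope iota bend V S) v = dot (cell_slope l s) v.
Proof.
move=> SE.
have slopeP : forall x, S x -> V x -> bend x = dot (iota x) (slope iota bend V S).
  have ex_w : exists w, forall x, S x -> V x -> bend x = dot (iota x) w.
    by exists (cell_slope l s) => x; rewrite SE => /cell_bend.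
  exact: (xgetPex 0 ex_w).
have [[[h [c [x [y [Sxy vE]]]]] _ _ _] _] := vnormalP dimS dimT face_subset.
rewrite !(dotC _ v) /v vE !dot_suml; apply: eq_bigr => i _; rewrite !dotZl; congr (_ * _).
apply: (affine_unique Pi_complex cS openV SV _ (Sxy i).1 (Sxy i).2) => z Sz Vz.
by rewrite -slopeP//; move: Sz; rewrite SE => /cell_bend.
Qed.

(* If every functional vanishing at [p] vanished on [S], then, the inequalities
   that define [S] being among the functionals, [S] would lie in the face [T]. *)
Lemma exists_transverse : exists2 j, dot (iota p) (l j) = 0 &
  exists2 x, S x & dot (iota x) (l j) != 0.
Proof.
apply: contrapT => no_j; apply: (has_dim_not_sub dimS dimT) => x Sx.
have vanish j : dot (iota p) (l j) = 0 -> dot (iota x) (l j) = 0.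
  move=> pj; apply/eqP; apply: contrapT => /negP xj; apply: no_j; exists j => //.
  by exists x.
have [S0 [s [PiS0 SE]]] := cS.
have S0U : restr Pi U S0.
  split=> //; have [z [Sz /VU Uz]] := SV; exists z; split=> //.
  by apply: (cell_sub (iota := iota) (l := l) (s := s)); rewrite -SE.
have [q [u [b [S0E ub]]]] := l_bounds S0U.
have SsolE : iota @` S = solutions (cell_normal l u s) (cell_bound b).
  by rewrite SE; exact: cell_solutions.
apply: (face_of_active SsolE faceT Tp Sx) => -[i|[j c]] /=.
  have [j lj] := ub i; move=> pi; have := vanish j.
  by rewrite lj !dotBr !dotZr !iota_a pi mulr1 subrr => /(_ erefl)/subr0_eq.
rewrite !dotZr => /eqP; rewrite mulf_eq0 => /orP[/eqP ->|/eqP /vanish ->].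
  by rewrite mul0r.
by rewrite mulr0.
Qed.

(** Subtracting a functional that depends on [p] only cancels every [l j] not vanishing at [p], its
    sign there being that of the cell. The other terms are nonnegative because [v] points into [S],
    and a transverse one is positive. *)
Lemma bend_normal_gt0 :
  0 < - dot (slope iota bend V S) v - dot (\sum_j Num.sg (dot (iota p) (l j)) *: l j) v.
Proof.
have [S0 [s [PiS0 SE]]] := cS.
have [[_ _ _ [x0 [y0 [Sx0 [Ty0 t_gt0]]]]] v_dual] := vnormalP dimS dimT face_subset.
rewrite -/v in t_gt0 v_dual.
have sgs x j : S x -> sg (s j) * dot (iota x) (l j) = `|dot (iota x) (l j)|.
  by rewrite SE => -[_]; exact.
have along j x y : dot (iota p) (l j) = 0 -> S x -> T y ->
    dot (iota x) (l j) = dot (iota x - iota y) v * dot v (l j).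
  move=> pj Sx Ty; rewrite -v_dual//; first by rewrite dotBl (p_relint pj Ty) subr0.
  by move=> z z' Tz Tz'; rewrite dotBl !(p_relint pj)// subrr.
rewrite (slope_bend SE) /cell_slope dotNl opprK !dot_suml -sumrB.
under eq_bigr do rewrite !dotZl -mulrBl (dotC _ v).
have sg_p j : dot (iota p) (l j) != 0 -> sg (s j) = Num.sg (dot (iota p) (l j)).
  by move=> pj; apply: (mulIf pj); rewrite -normrEsg (sgs _ _ (face_subset Tp)).
have term_ge0 j : 0 <= (sg (s j) - Num.sg (dot (iota p) (l j))) * dot v (l j).
  have [pj|pj] := eqVneq (dot (iota p) (l j)) 0; last by rewrite sg_p// subrr mul0r.
  rewrite pj sgr0 subr0; have := sgs _ j Sx0.
  rewrite (along j _ _ pj Sx0 Ty0) mulrCA => abs_eq.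
  by rewrite -(pmulr_rge0 _ t_gt0) abs_eq.
have [j pj [x Sx xj]] := exists_transverse.
rewrite (bigD1 j)//= ltr_pwDl//; last by apply: sumr_ge0 => i _.
rewrite lt_neqAle term_ge0 andbT eq_sym pj sgr0 subr0.
(* If [l j] vanished on [v], it would vanish at [x]; if its sign were 0, it would vanish at [x0],
   which has positive height above [T]. *)
have vj : dot v (l j) != 0.
  by apply: contra xj => /eqP vj; rewrite (along j _ _ pj Sx Tp) vj mulr0.
rewrite mulf_neq0//; apply/eqP => sj0; have := sgs _ j Sx0.
rewrite sj0 mul0r (along j _ _ pj Sx0 Ty0) => /esym/normr0_eq0/eqP.
by rewrite mulf_eq0 (negPf vj) orbF (gt_eqF t_gt0).
Qed.

End Facet.

Lemma bend_strictly_concave : strictly_concave iota cells U bend.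
Proof.
split=> [S [[S0 [s [_ ->]]] _]|k T V [[cT [z [Tz _]]] dimT] openV VU TV c c_ge0 mink].
  by exists (cell_slope l s) => x [xs _]; exact: cell_bend xs.
move=> [S1 [S1T cS1]].
have [T0 [t [PiT0 TE]]] := cT.
have [p Tp p_relint] : exists2 p, T p & forall j, dot (iota p) (l j) = 0 ->
    forall x, T x -> dot (iota x) (l j) = 0.
  (* On [T] the functional [- sg (t j) *: l j] is minus the absolute value of [l j], so tightness
     means that [l j] vanishes. *)
  have [||x Tx|p Tp p_relint] := @exists_relint _ _ _ iota _
      (fun j => - sg (t j) *: l j) (fun=> 0) T.
  - by rewrite TE; exact: (cell_midpoint Pi_complex PiT0).
  - by exists z.
  - move=> j; move: Tx; rewrite TE => -[_ /(_ j) xj].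
    by rewrite dotZr mulNr xj oppr_le0.
  exists p => // j pj x Tx; have := p_relint j; rewrite dotZr pj mulr0 => /(_ erefl _ Tx).
  move: Tx; rewrite TE => -[_ /(_ j) xj].
  by rewrite dotZr mulNr xj => /eqP; rewrite oppr_eq0 => /eqP/normr0_eq0.
have fin_cofaces : finite_set (cofaces iota cells V k T).
  apply: sub_finite_set (cells_finite iota l finite_U) => S [[[cS [x [Sx Vx]]] _] _].
  by split=> //; exists x; split=> //; exact: VU.
have faceP S : S \in cofaces iota cells V k T ->
    0 < - dot (slope iota bend V S) (vnormal iota S T)
      - dot (\sum_j Num.sg (dot (iota p) (l j)) *: l j) (vnormal iota S T).
  rewrite inE => -[[[cS SV] dimS] faceT].
  exact: (bend_normal_gt0 cS dimS dimT openV VU SV faceT Tp p_relint).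
set D := \sum_j _ in faceP.
(* The balancing condition at [T], paired with the functional [D] common to all cofaces; subtracting
   this zero makes each summand of [fdot] nonnegative. *)
have sumD : \sum_(S <- finmap.enum_fset (fset_set (cofaces iota cells V k T)))
    c S * dot D (vnormal iota S T) = 0.
  have := mink T (conj (conj cT TV) dimT); rewrite fsbig_finite// => /(congr1 (dot D)).
  rewrite dot0r dot_sumr => sum0; rewrite -[RHS]sum0.
  by apply: eq_bigr => S _; rewrite dotZr.
rewrite /fdot fsbig_finite// -(subr0 (- _)) -[X in _ - X]sumD -sumrN -sumrB.
rewrite (bigD1_seq S1) ?finmap.fset_uniq ?in_fset_set ?inE//=.
have termE S : - (c S * dot (slope iota bend V S) (vnormal iota S T)) -
     c S * dot D (vnormal iota S T) =
   c S * (- dot (slope iota bend V S) (vnormal iota S T) - dot D (vnormal iota S T)).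
  by ring.
rewrite ltr_pwDl//; first by rewrite termE mulr_gt0// faceP ?inE.
rewrite big_seq_cond; apply: sumr_ge0 => S; rewrite in_fset_set// => /andP[ST _].
rewrite termE mulr_ge0//; last exact/ltW/faceP.
by apply: c_ge0; move: ST; rewrite inE => -[].
Qed.

End StrictConcavity.

(** * Choice of the functionals and conclusion *)

Lemma exists_bounding_functionals (R : realType) (n : nat) (X : topologicalType)
    (iota : X -> 'rV[R]_n) (a : 'rV[R]_n) (Pi A : set (set X)) :
  is_complex iota Pi -> A `<=` Pi -> finite_set A ->
  exists m (l : 'I_m -> 'rV[R]_n), forall S, A S ->
    exists q (u : 'I_q -> 'rV[R]_n) (b : 'I_q -> R),
      iota @` S = solutions u b /\ forall i, exists j, l j = u i - b i *: a.
Proof.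
move=> Pi_complex APi finA.
have [ls lsP] : exists ls : seq 'rV[R]_n, forall S, S \in finmap.enum_fset (fset_set A) ->
    exists q (u : 'I_q -> 'rV[R]_n) (b : 'I_q -> R),
      iota @` S = solutions u b /\ forall i, u i - b i *: a \in ls.
  have : forall S, S \in finmap.enum_fset (fset_set A) -> Pi S.
    by move=> S; rewrite in_fset_set// inE => /APi.
  (* Induction on the list of polyhedra, prepending the homogenised inequalities of each. *)
  elim: (finmap.enum_fset _) => [|S r IHr] PiS; first by exists [::].
  have [ls lsP] : exists ls : seq 'rV[R]_n, forall S, S \in r ->
      exists q (u : 'I_q -> 'rV[R]_n) (b : 'I_q -> R),
        iota @` S = solutions u b /\ forall i, u i - b i *: a \in ls.
    by apply: IHr => T Tr; apply: PiS; rewrite inE Tr orbT.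
  have [q [u [b SE]]] := complex_solutions Pi_complex (PiS S (mem_head _ _)).
  exists ([seq u i - b i *: a | i <- enum 'I_q] ++ ls) => T; rewrite inE => /orP[/eqP ->|Tr].
    exists q, u, b; split=> // i; rewrite mem_cat; apply/orP; left.
    by apply/mapP; exists i; rewrite ?mem_enum.
  have [q' [u' [b' [TE uls]]]] := lsP _ Tr.
  by exists q', u', b'; split=> // i; rewrite mem_cat uls orbT.
exists (size ls), (fun j => nth 0 ls j) => S AS.
have [|q [u [b [SE uls]]]] := lsP S; first by rewrite in_fset_set// inE.
exists q, u, b; split=> // i; have ils := uls i.
have := ils; rewrite -index_mem => lt_ls.
by exists (Ordinal lt_ls); rewrite /= nth_index.
Qed.

Unset Implicit Arguments.

Theorem theorem4p22 (R : realType) (n : nat) (X : topologicalType)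
    (iota : X -> 'rV[R]_n) (a : 'rV[R]_n) (Pi : set (set X)) (U : set X) :
  @second_countable X ->
  (forall x, dot (iota x) a = 1) ->
  is_complex iota Pi ->
  open U ->
  finite_set (restr Pi U) ->
  exists f : X -> R,
    [/\ piecewise_affine iota Pi f,
        strongly_concave iota a f,
        finite_set (restr (S_of iota Pi f) U),
        strictly_concave iota (S_of iota Pi f) U f &
        [/\ is_complex iota (S_of iota Pi f),
            subdivides (S_of iota Pi f) Pi &
            regular iota (S_of iota Pi f) U]].
Proof.
move=> _ iota_a Pi_complex _ finU.
have restrPi : restr Pi U `<=` Pi by move=> S [].
have [m [l l_bounds]] := exists_bounding_functionals a Pi_complex restrPi finU.
have S_ofE : S_of iota Pi (bend iota l) = cells iota l Pi by exact: S_of_bend.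
have cC := cells_complex l Pi_complex.
have strict := bend_strictly_concave Pi_complex iota_a finU l_bounds.
exists (bend iota l); rewrite S_ofE; split.
(* [cells] refines both itself and [Pi], so it is its own common subdivision with [Pi]. *)
- exists (cells iota l Pi); split=> //; split.
    exists (cells iota l Pi); split=> //; split=> [S cS|_ [S [s [PiS ->]]]].
      by exists S; split=> // x.
    by exists S; split=> // x [].
  move=> _ [S [s [PiS ->]]]; exists (cell_slope l s) => x; exact: cell_bend.
- exact: bend_strongly_concave.
- exact: cells_finite.
- exact: strict.
- split=> //; last by exists (bend iota l).
  by move=> _ [S [s [PiS ->]]]; exists S; split=> // x [].
Qed.
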